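(* Let $\mathbb{K}\in\{\mathbb{R},\mathbb{C}\}$ and let $m\geq 1$ be an integer. Let $B_{m}^{\mathbb{K}}$ be the optimal (smallest) constant such that $$\left(\sum_{j_{1},\ldots,j_{m}=1}^{\infty}|T(e_{j_{1}},\ldots,e_{j_{m}})|^{\frac{2m}{m+1}}\right)^{\frac{m+1}{2m}}\leq B_{m}^{\mathbb{K}}\Vert T\Vert$$ for all continuous $m$-linear forms $T\colon c_{0}\times\cdots\times c_{0}\to\mathbb{K}$, and let $C_{m}^{\mathbb{K}}$ be the optimal (smallest) constant such that $$\left(\sum_{|\alpha|=m}|c_{\alpha}(P)|^{\frac{2m}{m+1}}\right)^{\frac{m+1}{2m}}\leq C_{m}^{\mathbb{K}}\Vert P\Vert$$ for all continuous $m$-homogeneous polynomials $P\colon c_{0}\to\mathbb{K}$. Then $$B_{m}^{\mathbb{K}}\leq C_{m}^{\mathbb{K}}.$$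
   Context: $c_{0}$ is the Banach space of all $\mathbb{K}$-valued sequences converging to $0$, with the sup norm, $B_{c_0}$ is its closed unit ball, and $e_{j}$ is its $j$-th canonical unit vector. For a continuous $m$-linear form $T\colon c_{0}\times\cdots\times c_{0}\to\mathbb{K}$, $\Vert T\Vert:=\sup\{|T(x^{(1)},\ldots,x^{(m)})| : \Vert x^{(j)}\Vert=1 \text{ for all } j\}$. A map $P\colon c_{0}\to\mathbb{K}$ is a continuous $m$-homogeneous polynomial if there is a continuous $m$-linear form $\hat{P}\colon c_{0}\times\cdots\times c_{0}\to\mathbb{K}$ with $P(x)=\hat{P}(x,\ldots,x)$ for all $x\in c_0$; its norm is $\Vert P\Vert:=\sup_{x\in B_{c_{0}}}|P(x)|$. For a sequence $\alpha=(\alpha_{j})_{j=1}^{\infty}$ in $\mathbb{N}\cup\{0\}$ put $|\alpha|:=\sum_j\alpha_{j}$ and $x^{\alpha}:=\prod_{j}x_{j}^{\alpha_{j}}$. For $|\alpha|=m$, $c_{\alpha}(P)$ is the coefficient of the monomial $x^{\alpha}$ in $P$, i.e. $P(x)=\sum_{|\alpha|=m}c_{\alpha}(P)x^{\alpha}$ for all finitely supported $x$. Both constants $B_m^{\mathbb{K}}$ and $C_m^{\mathbb{K}}$ are finite by the classical Bohnenblust--Hille inequalities. *)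

(* Defs.v *)
From HB Require Import structures.
From mathcomp Require Import all_boot all_order all_algebra.
From mathcomp Require Import all_classical all_reals all_analysis.
From mathcomp Require Import complex.

Set Implicit Arguments.
Unset Strict Implicit.
Unset Printing Implicit Defensive.
Import Order.TTheory GRing.Theory Num.Theory.
Import numFieldNormedType.Exports.

Local Open Scope classical_set_scope.
Local Open Scope ring_scope.

(* Sequences and multi-indices are indexed from 0 instead of 1. *)

Section c0.
Variable K : numFieldType.

Definition c0_pred : {pred (nat -> K^o)} :=
  fun x => `[< x @ \oo --> (0 : K) >].

Record c0 := C0 { c0_val :> nat -> K^o ; _ : c0_val \in c0_pred }.

HB.instance Definition _ := [isSub for c0_val].
HB.instance Definition _ := [Choice of c0 by <:].

Lemma c0_cvg (x : c0) : (x : nat -> K) @ \oo --> (0 : K).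
Proof. by case: x => x /= /asboolP. Qed.

Fact c0_pred_submod_closed : GRing.subsemimod_closed c0_pred.
Proof.
split; first split.
- by apply/asboolP; exact: cvg_cst.
- move=> x y /asboolP cx /asboolP cy; apply/asboolP.
  by rewrite -[0]addr0; exact: cvgD.
- move=> a x /asboolP cx; apply/asboolP.
  by rewrite -[0](mulr0 a); apply: cvgM => //; exact: cvg_cst.
Qed.

HB.instance Definition _ :=
  GRing.isSubmodClosed.Build K (nat -> K^o) c0_pred c0_pred_submod_closed.

HB.instance Definition _ := [SubChoice_isSubLmodule of c0 by <:].

(* The supremum is taken in the partially ordered field K, so that c0 is a
   normed K-module in the sense of the library for complex K as well; it is
   a genuine supremum, in fact a maximum ([c0_norm_max]). *)
Definition c0_norm (x : c0) : K := supremum 0 (range (fun j => `|x j| : K)).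

Lemma c0_bounded_max (x : c0) : exists j, forall k, (`|x k| : K) <= `|x j|.
Proof.
have [x0|/existsNP[k0 /eqP xk0]] := pselect (forall k, x k = 0 :> K).
  by exists 0%N => k; rewrite !x0.
have xk0_gt0 : 0 < (`|x k0| : K) by rewrite normr_gt0.
have [N _ small] : \forall k \near \oo, (`|x k| : K) < `|x k0|.
  have /cvgr0Pnorm_lt := @c0_cvg x; exact.
have max n : exists j, forall k, (k <= n)%N -> (`|x k| : K) <= `|x j|.
  elim: n => [|n [j jmax]]; first by exists 0%N => k; rewrite leqn0 => /eqP ->.
  have [le|/ltW le] := real_leP (normr_real (x j : K)) (normr_real (x n.+1 : K)).
    exists n.+1 => k; rewrite leq_eqVlt => /predU1P[->//|/jmax].
    by move/le_trans; exact.
  by exists j => k; rewrite leq_eqVlt => /predU1P[->//|/jmax].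
have [j jmax] := max (maxn N k0); exists j => k.
have [/small/ltW|/ltnW kN] := leqP N k; last first.
  by apply: jmax; rewrite leq_max kN.
by move/le_trans; apply; apply: jmax; rewrite leq_maxr.
Qed.

Lemma c0_norm_max (x : c0) :
  exists2 j, c0_norm x = `|x j| & forall k, `|x k| <= c0_norm x.
Proof.
have [j jmax] := c0_bounded_max x.
suff -> : c0_norm x = `|x j| by exists j.
have supj : supremums (range (fun k => `|x k| : K)) `|x j|.
  by split=> [_ [k _ <-]//|y]; apply; exists j.
rewrite /c0_norm /supremum ifF; last first.
  by apply/eqP => /seteqP[/(_ `|x j|) + _]; apply; exists j.
exact: (is_subset1_supremums (xgetPex 0 (ex_intro _ _ supj)) supj).
Qed.

Fact c0_normD (x y : c0) : c0_norm (x + y) <= c0_norm x + c0_norm y.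
Proof.
have [j -> _] := c0_norm_max (x + y).
have [_ _ xle] := c0_norm_max x; have [_ _ yle] := c0_norm_max y.
by apply: (le_trans (ler_normD _ _)); exact: lerD.
Qed.

Fact c0_normZ (a : K) (x : c0) : c0_norm (a *: x) = `|a| * c0_norm x.
Proof.
have [j axj axle] := c0_norm_max (a *: x).
have [k xk xle] := c0_norm_max x.
apply/le_anti/andP; split.
  by rewrite axj normrM ler_wpM2l.
by have := axle k; rewrite normrM -xk.
Qed.

Fact c0_norm_eq0 (x : c0) : c0_norm x = 0 -> x = 0.
Proof.
move=> x0; have [_ _ xle] := c0_norm_max x.
apply/val_inj/funext => k /=; apply/eqP.
by rewrite -normr_le0 -x0; exact: xle.
Qed.

HB.instance Definition _ :=
  Lmodule_isNormed.Build K c0 c0_normD c0_normZ c0_norm_eq0.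

Fact c0_unit_subproof (j : nat) : (fun k => (k == j)%:R : K^o) \in c0_pred.
Proof.
apply/asboolP/cvgr0Pnorm_lt => e e0; exists j.+1 => // k /= jk.
by rewrite gtn_eqF// normr0.
Qed.

Definition c0_unit (j : nat) : c0 := C0 (c0_unit_subproof j).

Definition multilinear (m : nat) (T : ('I_m -> c0) -> K) : Prop :=
  forall (x : 'I_m -> c0) (i : 'I_m), scalar (fun y : c0 => T (dfwith x i y)).

(* Continuity is with respect to the product topology on the m-fold product. *)
Definition continuous_multilinear (m : nat) (T : ('I_m -> c0) -> K) : Prop :=
  multilinear T /\ continuous (T : prod_topology (fun _ : 'I_m => c0) -> K).

Definition continuous_homogeneous (m : nat) (P : c0 -> K) : Prop :=
  exists2 T : ('I_m -> c0) -> K,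
    continuous_multilinear T & forall x, P x = T (fun=> x).

Definition multi_indices (m : nat) : set (nat -> nat) :=
  [set a | finite_set [set j | a j != 0%N] /\ (\sum_(j \in setT) a j = m)%R].

Definition monomial (a : nat -> nat) (x : c0) : K :=
  \big[*%R/1]_(j \in setT) ((x j : K) ^+ a j).

(* Only the values of c on multi_indices m matter; for finitely supported x
   only finitely many terms of the sum are nonzero. *)
Definition coefficients (m : nat) (P : c0 -> K) (c : (nat -> nat) -> K) :=
  forall x : c0, finite_set [set j | x j != 0] ->
    P x = \sum_(a \in multi_indices m) (c a * monomial a x).

End c0.

Section constants.
Variables (R : realType) (K : numFieldType) (modulus : K -> R) (m : nat).
Local Open Scope ereal_scope.

Definition multilinear_norm (T : ('I_m -> c0 K) -> K) : \bar R :=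
  ereal_sup [set (modulus (T x))%:E |
             x in [set x : 'I_m -> c0 K | forall i, `|x i|%R = 1%R]].

Definition polynomial_norm (P : c0 K -> K) : \bar R :=
  ereal_sup [set (modulus (P x))%:E | x in [set x : c0 K | (`|x| <= 1)%R]].

Definition BH_sum (I : choiceType) (D : set I) (f : I -> K) : \bar R :=
  (\esum_(i in D) (modulus (f i) `^ ((2 * m)%:R / m.+1%:R))%:E)
    `^ (m.+1%:R / (2 * m)%:R).

Definition BH_multilinear_bound (C : R) : Prop :=
  forall T : ('I_m -> c0 K) -> K, continuous_multilinear T ->
    BH_sum [set: 'I_m -> nat] (fun j => T (fun i => c0_unit K (j i)))
      <= C%:E * multilinear_norm T.

Definition BH_polynomial_bound (C : R) : Prop :=
  forall (P : c0 K -> K) (c : (nat -> nat) -> K),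
    continuous_homogeneous m P -> coefficients m P c ->
    BH_sum (multi_indices m) c <= C%:E * polynomial_norm P.

(* The optimal constants, as extended reals: an infimum over the empty set
   would be +oo, so that their finiteness is not presupposed. *)
Definition BH_multilinear_constant : \bar R :=
  ereal_inf [set C%:E | C in BH_multilinear_bound].

Definition BH_polynomial_constant : \bar R :=
  ereal_inf [set C%:E | C in BH_polynomial_bound].

End constants.

Variant scalar_kind := RealScalars | ComplexScalars.

Definition scalars (R : realType) (k : scalar_kind) : numFieldType :=
  match k with RealScalars => R | ComplexScalars => R[i] end.

(* The norm of the library on R[i] is R[i]-valued; this is the R-valued one. *)
Definition modulus (R : realType) (k : scalar_kind) : scalars R k -> R :=
  match k with
  | RealScalars => fun x : R => `|x|
  | ComplexScalars => fun z : R[i] => complex.Re `|z|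
  end.

(* Main.v *)
Require Import Defs.
From mathcomp Require Import all_boot all_order all_algebra.
From mathcomp Require Import all_classical all_reals all_analysis.
From mathcomp Require Import complex.

Set Implicit Arguments.
Unset Strict Implicit.
Unset Printing Implicit Defensive.
Import Order.TTheory GRing.Theory Num.Theory.
Import numFieldNormedType.Exports.

Local Open Scope classical_set_scope.
Local Open Scope ring_scope.

(* Given an m-linear form T, split a sequence x into its m strands
   x^(i)_k = x_(m k + i) and let P x = T (x^(0), ..., x^(m-1)).  Splitting
   identifies the unit ball of c_0 with the product of m unit balls, so that
   P and T have the same norm.  The polynomial P is supported on the monomials
   \prod_i x_(m j_i + i), which are pairwise distinct for distinct indices j,
   so the coefficients of P are exactly the values T (e_(j_0), ..., e_(j_(m-1)))
   and zeros.  Hence every constant admissible for polynomials is admissible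
   for multilinear forms. *)

(** * Reindexing and monotonicity of sums *)

Lemma fsbig_range (R : Type) (idx : R) (op : Monoid.com_law idx) (I : finType)
    (J : choiceType) (h : I -> J) (D : set J) (F : J -> R) :
    injective h -> range h `<=` D ->
    (forall j, D j -> ~ range h j -> F j = idx) ->
  \big[op/idx]_(j \in D) F j = \big[op/idx]_i F (h i).
Proof.
move=> h_inj hD F1; rewrite -(fsbig_widen (range h) D) => [|//|j [Dj hj]];
  last exact: F1.
rewrite (reindex_fsbig h setT); last by apply: inj_bij; exact: in2W.
rewrite (fsbigE (index_enum I)).
- by apply: eq_bigl => i; rewrite in_setT.
- exact: index_enum_uniq.
- by [].
- by move=> i _; rewrite mem_index_enum.
Qed.

Lemma subset_esum (R : realType) (T : choiceType) (A B : set T)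
    (f : T -> \bar R) :
  A `<=` B -> (\esum_(i in A) f i <= \esum_(i in B) f i)%E.
Proof.
move=> AB; apply/le_ereal_sup/image_subset => X [finX XA].
by split=> //; exact: subset_trans AB.
Qed.

(** * Norm estimates and finite expansions in [c0] *)

Section c0_lemmas.
Variable K : numFieldType.
Implicit Types x : c0 K.

Lemma c0_coord_le x k : `|x k : K| <= `|x|.
Proof. by have [_ _] := c0_norm_max x; apply. Qed.

Lemma c0_norm_le x (C : K) : (forall k, `|x k : K| <= C) -> `|x| <= C.
Proof. by move=> xC; have [j /= xj _] := c0_norm_max x; rewrite [`|x|]xj. Qed.

Lemma c0_unit_norm j : `|c0_unit K j| = 1.
Proof.
apply/le_anti/andP; split.
  apply: c0_norm_le => k /=.
  by case: (k == j); rewrite ?normr0 ?normr1 ?lexx ?ler01.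
by apply: le_trans (c0_coord_le _ j); rewrite /= eqxx normr1.
Qed.

(** Bridges the two norms: [polynomial_norm] is a supremum over the unit ball, [multilinear_norm]
    one over unit spheres. At zero any unit vector serves as [u]. *)
Lemma c0_polar x : `|x| <= 1 ->
  exists a u, [/\ x = a *: u, `|u| = 1 & `|a| <= 1].
Proof.
move=> x1; have [->|x0] := eqVneq x 0.
  by exists 0, (c0_unit K 0); rewrite scale0r c0_unit_norm normr0 ler01.
exists `|x|, (`|x|^-1 *: x); rewrite scalerA divff ?normr_eq0// scale1r.
by rewrite normrZ normfV normr_id mulVf ?normr_eq0.
Qed.

Lemma c0_finite_sum x N : (forall k, (N <= k)%N -> x k = 0) ->
  x = \sum_(k < N) (x k : K) *: c0_unit K k.
Proof.
move=> xN; apply/val_inj/funext => k.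
rewrite [RHS](_ : _ = \sum_(l < N) (x l : K) * (k == l)%:R); last first.
  elim/big_ind2 : _ => // u _ v _ <- <- //.
have [kN|Nk] := ltnP k N.
  rewrite (bigD1 (Ordinal kN))//= eqxx mulr1 big1 ?addr0// => l lk.
  by rewrite (_ : (k == l) = false) ?mulr0//; apply/negbTE; rewrite eq_sym.
rewrite big1 => [|l _]; first exact: xN.
by rewrite gtn_eqF ?mulr0// (leq_trans _ Nk).
Qed.

End c0_lemmas.

(** The product topology is the supremum of the topologies pulled back along the projections, so
    convergence can be tested in each of these. *)
Lemma continuous_prod_topology (S : topologicalType) (I : eqType)
    (T : I -> topologicalType) (f : S -> prod_topology T) :
  (forall i, continuous (fun s => f s i)) -> continuous f.
Proof.
move=> f_cont s; apply/cvg_sup => i A [_ [[B oB <-] Bfsi] BA].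
by apply: filterS BA _; apply: f_cont; apply: open_nbhs_nbhs.
Qed.

(** * Expansion and homogeneity of multilinear forms *)

Section multilinear.
Variables (K : numFieldType) (m : nat) (T : ('I_m -> c0 K) -> K).
Hypothesis T_lin : multilinear T.

Lemma multilinear_sum (x : 'I_m -> c0 K) i N (a : 'I_N -> K)
    (e : 'I_N -> c0 K) :
  T (dfwith x i (\sum_k a k *: e k)) = \sum_k a k * T (dfwith x i (e k)).
Proof.
have T0 : T (dfwith x i 0) = 0.
  have := T_lin x i 1 0 0; rewrite scaler0 addr0 mul1r => /eqP.
  by rewrite -subr_eq0 opprD addNKr oppr_eq0 => /eqP.
elim/big_ind2 : _ => // [_ y _ z <- <-|k _].
  by have := T_lin x i 1 y z; rewrite scale1r mul1r.
by have := T_lin x i (a k) (e k) 0; rewrite !addr0 T0 addr0.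
Qed.

Lemma multilinear_expand N (a : 'I_m -> 'I_N -> K) (e : 'I_m -> 'I_N -> c0 K) :
  T (fun i => \sum_k a i k *: e i k) =
  \sum_(f : {ffun 'I_m -> 'I_N}) (\prod_i a i (f i)) * T (fun i => e i (f i)).
Proof.
(* Induction on the number of coordinates not yet known to be a single e i k. *)
suff main n : forall b : 'I_m -> 'I_N -> K,
    (forall i : 'I_m, (n <= i)%N -> exists k, b i = fun l => (l == k)%:R) ->
    T (fun i => \sum_k b i k *: e i k) = \sum_(f : {ffun 'I_m -> 'I_N})
      (\prod_i b i (f i)) * T (fun i => e i (f i)).
  by apply: (main m) => i; rewrite leqNgt ltn_ord.
elim: n => [b b0|n IHn b bn].
  have /choice[k bk] i : exists k, b i = fun l => (l == k)%:R by exact: b0.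
  (* All rows of [b] are indicators, so only the function selecting their indices contributes. *)
  rewrite (bigD1 (finfun k))//= big1 ?mul1r ?big1 ?addr0 => [|f fk|i _].
  - congr T; apply/funext => i; rewrite ffunE (bigD1 (k i))//= bk eqxx scale1r.
    by rewrite big1 ?addr0// => l /negbTE ->; rewrite scale0r.
  - have [i fik] : exists i, f i != k i.
      apply/existsP; apply: contraR fk => /existsPn fk.
      by apply/eqP/ffunP => i; rewrite ffunE; apply/eqP/negPn/fk.
    by rewrite (bigD1 i)//= bk (negbTE fik) !mul0r.
  - by rewrite bk ffunE eqxx.
have [nm|mn] := ltnP n m; last first.
  by apply: IHn => i ni; have := ltn_ord i; rewrite ltnNge (leq_trans mn ni).
pose i0 := Ordinal nm; pose x i := \sum_k b i k *: e i k.
(* [b' k] replaces row [i0] by the indicator of [k], which brings it within reach of the induction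
   hypothesis. *)
pose b' k i l := if i == i0 then (l == k)%:R else b i l.
rewrite -/x (_ : x = dfwith x i0 (\sum_k b i0 k *: e i0 k)); last first.
  by apply/funext => i; case: dfwithP.
rewrite multilinear_sum.
transitivity (\sum_k b i0 k * \sum_(f : {ffun 'I_m -> 'I_N})
    (\prod_i b' k i (f i)) * T (fun i => e i (f i))).
  apply: eq_bigr => k _; rewrite -IHn => [|i].
    congr (_ * T _); apply/funext => i; case: dfwithP => [|j ij].
      rewrite (bigD1 k)//= /b' !eqxx scale1r big1 ?addr0// => l /negbTE ->.
      by rewrite scale0r.
    by apply: eq_bigr => l _; rewrite /b' eq_sym (negbTE ij).
  rewrite leq_eqVlt => /predU1P[ni|ni].
    exists k; apply/funext => l; rewrite /b' (_ : i = i0) ?eqxx//.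
    exact/val_inj.
  have [l bl] := bn i ni; exists l; rewrite -bl; apply/funext => l'.
  by rewrite /b' -val_eqE/= gtn_eqF.
under eq_bigr do rewrite mulr_sumr.
rewrite exchange_big; apply: eq_bigr => f _ /=.
(* For fixed [f] the factor at [i0] is the indicator of [k] at [f i0], so only [k = f i0] survives
   and restores the factor [b i0 (f i0)]. *)
rewrite (bigD1 (f i0))//= [X in _ + X]big1 => [|k kf]; last first.
  by rewrite (bigD1 i0)//= /b' eqxx eq_sym (negbTE kf) !mul0r mulr0.
rewrite addr0 mulrA (bigD1 i0)//= [in RHS](bigD1 i0)//= /b' !eqxx mul1r.
by congr (_ * _ * _); apply: eq_bigr => i /negbTE ->.
Qed.

(** The case of one-term sums in [multilinear_expand]: there is a single function into ['I_1]. *)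
Lemma multilinearZ (a : 'I_m -> K) (x : 'I_m -> c0 K) :
  T (fun i => a i *: x i) = (\prod_i a i) * T x.
Proof.
have := multilinear_expand (fun i (_ : 'I_1) => a i) (fun i _ => x i).
under eq_fun do rewrite big_ord1; move=> ->.
rewrite (bigD1 [ffun=> ord0])//= [X in _ + X]big1 ?addr0// => f /eqP[].
by apply/ffunP => i; rewrite ord1 ffunE.
Qed.

(** Normalise each argument by [c0_polar]; the extracted scalars multiply to one of norm at most
    1. *)
Lemma multilinear_sphere (x : 'I_m -> c0 K) : (forall i, `|x i| <= 1) ->
  exists2 u, forall i, `|u i| = 1 & exists2 a, `|a| <= 1 & T x = a * T u.
Proof.
move=> x1; have /choice[a] i := c0_polar (x1 i).
move=> /choice[u /all_and3[xE u1 a1]]; exists u => //.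
exists (\prod_i a i).
  by rewrite normr_prod; apply: prodr_ile1 => i _; rewrite normr_ge0 a1.
by rewrite -multilinearZ; congr T; apply/funext.
Qed.

End multilinear.

(** * Splitting a sequence into strands, interleaving, and the associated monomials *)

Section strands.
Variables (K : numFieldType) (m : nat).

Definition strand_index (i : 'I_m) (k : nat) : nat := (k * m + i)%N.

Lemma strand_index_inj i i' k k' :
  strand_index i k = strand_index i' k' -> i = i' /\ k = k'.
Proof.
rewrite /strand_index => e.
have m0 : (0 < m)%N := leq_ltn_trans (leq0n i) (ltn_ord i).
split.
  apply/val_inj; move/(congr1 (modn^~ m)): e.
  by rewrite !modnMDl !modn_small.
move/(congr1 (divn^~ m)): e.
by rewrite !divnMDl// !divn_small// !addn0.
Qed.

(** Lets a strand inherit tail estimates from the full sequence: decay in [strand_subproof], and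
    later vanishing beyond a fixed index. *)
Lemma leq_strand_index i k : (k <= strand_index i k)%N.
Proof.
rewrite (leq_trans _ (leq_addr _ _))// leq_pmulr//.
exact: leq_ltn_trans (ltn_ord i).
Qed.

Fact strand_subproof (i : 'I_m) (x : c0 K) :
  (fun k => x (strand_index i k)) \in @c0_pred K.
Proof.
apply/asboolP/cvgr0Pnorm_lt => e e0.
have /cvgr0Pnorm_lt/(_ e e0)[N _ xN] := @c0_cvg _ x; exists N => // k /= Nk.
by apply: xN => /=; exact: leq_trans (leq_strand_index i k).
Qed.

Definition strand (i : 'I_m) (x : c0 K) : c0 K := C0 (strand_subproof i x).

Lemma strand_norm i x : `|strand i x| <= `|x|.
Proof.
by apply: c0_norm_le => k; exact: (c0_coord_le x (strand_index i k)).
Qed.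

Lemma strand_linear i a x y :
  strand i (a *: x + y) = a *: strand i x + strand i y.
Proof. exact/val_inj. Qed.

(** Strands are linear and do not increase the norm, hence are 1-Lipschitz. *)
Lemma strand_continuous i : continuous (strand i).
Proof.
move=> x; have Fx : Filter (nbhs x) by exact: nbhs_filter.
apply/(@cvgrPdist_lt _ _ _ (nbhs x) Fx) => e e0.
near=> y; rewrite -[- strand i y]scaleN1r addrC -strand_linear scaleN1r addrC.
apply: le_lt_trans (strand_norm _ _) _.
by near: y; exact: cvgr_dist_lt.
Unshelve. all: by end_near.
Qed.

(** Inverts the splitting through division with remainder by [m]. Quantifying over [C] avoids
    forming a maximum of norms in the partially ordered [K]. *)
Lemma interleave_exists (hm : (0 < m)%N) (v : 'I_m -> c0 K) :
  exists2 x, forall i, strand i x = v i &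
    forall C, (forall i, `|v i| <= C) -> `|x| <= C.
Proof.
pose x n : K^o := v (Ordinal (ltn_pmod n hm)) (n %/ m)%N.
have xE i k : x (strand_index i k) = v i k.
  rewrite /x /strand_index divnMDl// divn_small// addn0.
  congr (c0_val (v _) k); apply/val_inj.
  by rewrite /= modnMDl modn_small.
suff x_c0 : x \in @c0_pred K.
  exists (C0 x_c0) => [i|C vC]; first by apply/val_inj/funext => k; exact: xE.
  by apply: c0_norm_le => n; exact: le_trans (c0_coord_le _ _) (vC _).
apply/asboolP/cvgr0Pnorm_lt => e e0.
have /choice[N vN] i : exists N, forall k, (N <= k)%N -> `|v i k : K| < e.
  have /cvgr0Pnorm_lt/(_ e e0)[N _ vN] := @c0_cvg _ (v i).
  by exists N => k; exact: vN.
(* Beyond this index the quotient [n %/ m] is at least every [N i], whichever strand the remainder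
   selects. *)
exists ((\max_i N i) * m)%N => // n /= Nn; apply: vN.
by rewrite leq_divRL// (leq_trans _ Nn)// leq_mul2r leq_bigmax orbT.
Qed.

(** Exponents of the squarefree monomial attached to [j]; the boolean is coerced to 0 or 1. *)
Definition strand_exponent (j : 'I_m -> nat) (k : nat) : nat :=
  [exists i, strand_index i (j i) == k].

Lemma strand_index_injr (j : 'I_m -> nat) :
  injective (fun i => strand_index i (j i)).
Proof. by move=> i i' /strand_index_inj[]. Qed.

Lemma strand_exponentP j k :
  strand_exponent j k != 0%N <-> exists i, strand_index i (j i) = k.
Proof.
rewrite /strand_exponent eqb0 negbK; split => [/existsP[i /eqP]|[i ik]].
  by exists i.
by apply/existsP; exists i; apply/eqP.
Qed.

Lemma strand_exponentE j i : strand_exponent j (strand_index i (j i)) = 1%N.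
Proof.
by rewrite /strand_exponent (_ : [exists _, _])//; apply/existsP; exists i.
Qed.

(** The support of [strand_exponent j] meets the residue class of [i] modulo [m] only at
    [strand_index i (j i)], which determines [j i]. *)
Lemma strand_exponent_inj : injective strand_exponent.
Proof.
move=> j j' jj'; apply/funext => i.
have /strand_exponentP[i' /strand_index_inj[->]] :
    strand_exponent j' (strand_index i (j i)) != 0%N.
  by rewrite -jj' strand_exponentE.
by [].
Qed.

Lemma strand_exponent_multi_indices j : multi_indices m (strand_exponent j).
Proof.
split.
  apply: (@sub_finite_set _ _ (range (fun i => strand_index i (j i)))).
    by move=> k /= /strand_exponentP[i <-]; exists i.
  exact: finite_image.
rewrite (fsbig_range _ (strand_index_injr (j := j))) => [|//|k _ nk].
  under eq_bigr do rewrite strand_exponentE.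
  by rewrite big_const_ord iter_addr_0 natn.
apply/eqP; apply: contra_notT nk => /strand_exponentP[i ik].
by exists i.
Qed.

Lemma monomial_strand_exponent (x : c0 K) j :
  monomial (strand_exponent j) x = \prod_i (strand i x (j i) : K).
Proof.
rewrite /monomial (fsbig_range _ (strand_index_injr (j := j))) => [|//|k _ nk].
  by apply: eq_bigr => i _; rewrite strand_exponentE expr1.
suff -> : strand_exponent j k = 0%N by rewrite expr0.
apply/eqP; apply: contra_notT nk => /strand_exponentP[i ik].
by exists i.
Qed.

End strands.

(** * The interleaved polynomial and its coefficients *)

Section interleaved_polynomial.
Variables (K : numFieldType) (m : nat) (T : ('I_m -> c0 K) -> K).
Hypothesis T_cont : continuous_multilinear T.

Definition interleaved_poly (x : c0 K) : K := T (fun i => strand i x).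

(** [xget] decodes the index [j] from its exponent sequence; its default is never reached, because
    [a] lies in the range. *)
Definition interleaved_coef (a : nat -> nat) : K :=
  if a \in range (@strand_exponent m) then
    T (fun i => c0_unit K (xget (fun=> 0%N) [set j | strand_exponent j = a] i))
  else 0.

Lemma interleaved_coefE j :
  interleaved_coef (strand_exponent j) = T (fun i => c0_unit K (j i)).
Proof.
rewrite /interleaved_coef ifT; last by rewrite inE; exists j.
have : [set j' | strand_exponent j' = strand_exponent j] j by [].
by move/(xgetI (fun=> 0%N)) => /strand_exponent_inj ->.
Qed.

(** The witness applies the [i]-th strand map to the [i]-th argument before [T]; it need not be
    symmetric. *)
Lemma interleaved_poly_continuous_homogeneous :
  continuous_homogeneous m interleaved_poly.
Proof.
have [T_lin T_c] := T_cont.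
exists (fun y => T (fun i => strand i (y i))) => //; split.
  move=> x i a u v.
  have E y : (fun i' => strand i' (dfwith x i y i')) =
      dfwith (fun i' => strand i' (x i')) i (strand i y).
    apply/funext => i'.
    have [<-|ii'] := eqVneq i i'; first by rewrite !dfwithin.
    by rewrite !dfwithout.
  by rewrite /= !E strand_linear T_lin.
move=> y.
apply: (@continuous_comp _ (prod_topology (fun _ : 'I_m => c0 K))); last first.
  exact: T_c.
move: y; apply: continuous_prod_topology => i y.
apply: continuous_comp; first exact: proj_continuous.
exact: strand_continuous.
Qed.

Lemma interleaved_poly_coefficients :
  coefficients m interleaved_poly interleaved_coef.
Proof.
move=> x x_fin; have [T_lin _] := T_cont.
have [N xN] : exists N, forall k, (N <= k)%N -> x k = 0.
  have [s sE] := (finite_seqP _).1 x_fin.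
  exists (\max_(k <- s) k).+1 => k sk; apply: contraTeq sk => xk.
  have ks : k \in s by have : [set` s] k by rewrite -sE.
  by rewrite -ltnNge ltnS leq_bigmax_seq.
have strandE i : strand i x = \sum_(k < N) (strand i x k : K) *: c0_unit K k.
  apply: c0_finite_sum => k Nk; apply: xN.
  exact: leq_trans (leq_strand_index i k).
pose h (f : {ffun 'I_m -> 'I_N}) := strand_exponent (fun i => f i).
transitivity (T (fun i => \sum_(k < N) (strand i x k : K) *: c0_unit K k)).
  by congr T; exact/funext.
(* Each [f] in the expansion yields the monomial of exponent [h f]. *)
rewrite (multilinear_expand T_lin (fun i k => strand i x k : K)).
rewrite (fsbig_range _ (h := h)).
- apply: eq_bigr => f _.
  by rewrite interleaved_coefE monomial_strand_exponent mulrC.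
- move=> f g /strand_exponent_inj fg; apply/ffunP => i; apply/val_inj.
  exact: (congr1 (@^~ i) fg).
- by move=> _ [f _ <-]; exact: strand_exponent_multi_indices.
(* A multi-index outside the range of [h] contributes zero: either it encodes some [j] with an entry
   [j i] at least [N], and the monomial vanishes at [x], or it encodes no [j], and the coefficient
   is zero. *)
move=> a _ ha; have [/set_mem[j _ ja]|aj] :=
    boolP (a \in range (@strand_exponent m)).
  have [i Nji] : exists i, (N <= j i)%N.
    apply: contra_notP ha => /forallNP jN.
    have {}jN i : (j i < N)%N by rewrite ltnNge; exact/negP.
    exists [ffun i => Ordinal (jN i)] => //.
    rewrite -ja /h; congr strand_exponent.
    by apply/funext => i; rewrite ffunE.
  rewrite -ja monomial_strand_exponent (bigD1 i)//= xN ?mul0r ?mulr0//.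
  exact: leq_trans (leq_strand_index i _).
by rewrite /interleaved_coef (negbTE aj) mul0r.
Qed.

End interleaved_polynomial.

(** * Comparison of norms and of coefficient sums *)

Section norms.
Variables (R : realType) (K : numFieldType) (modulus : K -> R) (m : nat).
Hypothesis modulus_mul_le :
  forall a b, `|a| <= 1 -> modulus (a * b) <= modulus b.
Hypothesis m_gt0 : (0 < m)%N.
Variable T : ('I_m -> c0 K) -> K.
Hypothesis T_lin : multilinear T.

Lemma interleaved_poly_norm :
  polynomial_norm modulus (interleaved_poly T) = multilinear_norm modulus T.
Proof.
apply/le_anti/andP; split; apply: ge_ereal_sup => _ [x x1 <-].
  have [u u1 [a a1]] := multilinear_sphere T_lin
    (fun i => le_trans (strand_norm i x) x1).
  rewrite /interleaved_poly => ->.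
  apply: (@le_trans _ _ (modulus (T u))%:E).
    by rewrite lee_fin modulus_mul_le.
  by apply: ereal_sup_ubound; exists u.
have [y yx y1] := interleave_exists m_gt0 x.
apply: ereal_sup_ubound; exists y; first by apply: y1 => i; rewrite x1.
by rewrite /interleaved_poly; congr (modulus (T _))%:E; exact/funext.
Qed.

(** By injectivity of [strand_exponent], the multilinear sum is the part of the polynomial sum
    indexed by its range. *)
Lemma interleaved_BH_sum :
  (BH_sum modulus m [set: 'I_m -> nat] (fun j => T (fun i => c0_unit K (j i)))
    <= BH_sum modulus m (multi_indices m) (interleaved_coef T))%E.
Proof.
apply: gt0_ler_poweR.
- by rewrite divr_ge0.
- rewrite in_itv/= leey andbT; apply: esum_ge0 => *.
  by rewrite lee_fin powR_ge0.
- rewrite in_itv/= leey andbT; apply: esum_ge0 => *.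
  by rewrite lee_fin powR_ge0.
under eq_esum do rewrite -interleaved_coefE.
have bij : set_bij setT (range (@strand_exponent m)) (@strand_exponent m).
  by apply: inj_bij; exact: (in2W (@strand_exponent_inj m)).
rewrite -(reindex_esum _ _ _
  (fun a => (modulus (interleaved_coef T a) `^ ((2 * m)%:R / m.+1%:R))%:E) bij).
apply: subset_esum => _ [j _ <-]; exact: strand_exponent_multi_indices.
Qed.

End norms.

(** Keeping the modulus abstract, with a single contraction property, handles real and complex
    scalars together. *)
Lemma BH_multilinear_le_polynomial (R : realType) (K : numFieldType)
    (modulus : K -> R) (m : nat) :
    (forall a b, `|a| <= 1 -> modulus (a * b) <= modulus b) -> (0 < m)%N ->
  (BH_multilinear_constant modulus m <= BH_polynomial_constant modulus m)%E.
Proof.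
move=> modulus_mul_le m_gt0; apply/le_ereal_inf/image_subset => C CP T T_cont.
have [T_lin _] := T_cont.
rewrite -(interleaved_poly_norm modulus_mul_le m_gt0 T_lin).
apply: le_trans (interleaved_BH_sum modulus T) _.
by apply: CP; [exact: interleaved_poly_continuous_homogeneous
              |exact: interleaved_poly_coefficients].
Qed.

Lemma modulus_mul_le (R : realType) (k : scalar_kind) (a b : scalars R k) :
  `|a| <= 1 -> modulus (a * b) <= modulus b.
Proof.
case: k a b => /= a b a1.
  by rewrite normrM ler_piMl.
(* An inequality in [R[i]] includes the inequality of the real parts, which is the claim. *)
have : `|a * b| <= `|b| by rewrite normrM ler_piMl.
by rewrite lecE => /andP[].
Qed.

Theorem proposition1 (R : realType) (k : scalar_kind) (m : nat) (hm : (1 <= m)%N) :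
  (BH_multilinear_constant (@modulus R k) m
     <= BH_polynomial_constant (@modulus R k) m)%E.
Proof. exact/BH_multilinear_le_polynomial/hm/modulus_mul_le. Qed.
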